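(* Let $a,b,m,n\geqslant 1$ be integers. Then $$\frac{1-q^{am}}{1-q^{m+n}}{am+bm-1\brack am}_q{an+bn\brack an}_q$$ is a polynomial in $q$ with non-negative integer coefficients.
   Context: The $q$-binomial coefficients are defined by ${n\brack k}_q=\dfrac{(1-q^n)(1-q^{n-1})\cdots(1-q^{n-k+1})}{(1-q)(1-q^2)\cdots(1-q^k)}$ if $0\leqslant k\leqslant n$, and ${n\brack k}_q=0$ otherwise. Here $q$ is an indeterminate. *)

(* Defs.v *)
From mathcomp Require Import all_boot all_order all_algebra.

Set Implicit Arguments.
Unset Strict Implicit.
Unset Printing Implicit Defensive.

Import GRing.Theory.
Local Open Scope ring_scope.

(* Q(q), as the field of fractions of Z[q]. *)
Notation Qq := {fraction {poly int}}.

Definition qvar : Qq := tofrac 'X.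

Definition qbinom (F : fieldType) (q : F) (n k : nat) : F :=
  if (k <= n)%N then
    (\prod_(0 <= i < k) (1 - q ^+ (n - i))) / (\prod_(1 <= i < k.+1) (1 - q ^+ i))
  else 0.

(* Main.v *)
(** Write A for the product of the two Gaussian polynomials. By Sylvester's theorem
each factor, hence A, is palindromic and unimodal, so A is a sum of segments
q^i + ... + q^(D-i) with the same centre D/2. The coefficients of (1 - q^g) A are
therefore nonnegative up to degree (D + g)/2 and nonpositive from there on. If
B (1 - q^N) = (1 - q^g) A for a polynomial B, solving for the coefficients of B
upwards on the first range and downwards on the second shows that they are
nonnegative.

That 1 - q^(m+n) divides (1 - q^(am)) A is checked at the complex roots of unity z
with z^(m+n) = 1. If z has order d and z^(am) <> 1, one of the two Gaussian
polynomials vanishes at z, because [n, k] does so as soon as n mod d < k mod d.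

Sylvester's theorem comes from the action of sl2 on the k-th exterior power of its
irreducible representation with basis indexed by the sites 0, ..., n: the raising
operator is injective on weight spaces below the middle, and the weight space of
energy r has a basis indexed by the k-subsets with element sum r, whose number is a
coefficient of a Gaussian polynomial. *)

Require Import Defs.
From mathcomp Require Import all_boot all_order all_algebra all_field.
From mathcomp Require Import ring zify.

Set Implicit Arguments.
Unset Strict Implicit.
Unset Printing Implicit Defensive.

Import Order.TTheory GRing.Theory Num.Theory.
Local Open Scope ring_scope.

(** * Gaussian polynomials *)

(** The q-Pascal recursion makes the coefficients integers by construction, with no division;
    [qbinomE] recovers the quotient formula. *)
Fixpoint gauss (n k : nat) : {poly int} :=
  match n, k with
  | _, 0%N => 1
  | 0%N, _.+1 => 0
  | n'.+1, k'.+1 => gauss n' k'.+1 + 'X^(n' - k') * gauss n' k'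
  end.

Definition qfact (n : nat) : {poly int} := \prod_(1 <= i < n.+1) (1 - 'X^i).

Lemma gauss0 n : gauss n 0 = 1. Proof. by case: n. Qed.

Lemma gaussS n k :
  gauss n.+1 k.+1 = gauss n k.+1 + 'X^(n - k) * gauss n k.
Proof. by []. Qed.

Lemma gauss_small n k : (n < k)%N -> gauss n k = 0.
Proof.
elim: n k => [|n IHn] [|k] //= lt_nk.
by rewrite !IHn ?mulr0 ?addr0 // ltnW.
Qed.

Lemma qfactS n : qfact n.+1 = qfact n * (1 - 'X^(n.+1)).
Proof. by rewrite /qfact big_nat_recr. Qed.

Lemma qfact0 : qfact 0 = 1. Proof. by rewrite /qfact big_geq. Qed.

Lemma qint_neq0 n : (0 < n)%N -> 1 - 'X^n != 0 :> {poly int}.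
Proof.
move=> n_gt0; rewrite subr_eq0; apply/eqP => /(congr1 (fun p => size (p : {poly int}))).
by rewrite size_poly1 size_polyXn; case: n n_gt0.
Qed.

Lemma qfact_neq0 n : qfact n != 0.
Proof.
elim: n => [|n IHn]; first by rewrite qfact0 oner_eq0.
by rewrite qfactS mulf_neq0 ?qint_neq0.
Qed.

Lemma gaussnn n : gauss n n = 1.
Proof.
by elim: n => //= n IHn; rewrite gauss_small // IHn subnn add0r mul1r.
Qed.

(** Both terms of the Pascal rule become multiples of [qfact (k + l.+1)], with cofactors adding up
    by (1 - q^(l+1)) + q^(l+1) (1 - q^(k+1)) = 1 - q^(k+l+2). *)
Lemma gauss_qfact k l : gauss (k + l) k * (qfact k * qfact l) = qfact (k + l).
Proof.
elim: k l => [|k IHk] l; first by rewrite gauss0 qfact0 !mul1r.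
elim: l => [|l IHl].
  by rewrite addn0 gaussnn qfact0 mul1r mulr1.
rewrite addSn gaussS addKn !qfactS.
rewrite mulrDl.
have -> : gauss (k + l.+1) k.+1 * (qfact k * (1 - 'X^(k.+1)) * (qfact l * (1 - 'X^(l.+1))))
    = qfact (k + l.+1) * (1 - 'X^(l.+1)).
  by rewrite addnS -addSn -IHl qfactS; ring.
have -> : 'X^(l.+1) * gauss (k + l.+1) k * (qfact k * (1 - 'X^(k.+1)) * (qfact l * (1 - 'X^(l.+1))))
    = qfact (k + l.+1) * ('X^(l.+1) * (1 - 'X^(k.+1))).
  by rewrite -IHk qfactS; ring.
have -> : 'X^((k + l.+1).+1) = 'X^(k.+1) * 'X^(l.+1) :> {poly int} by rewrite -exprD addSn.
ring.
Qed.

Lemma gauss_absorb n k :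
  (1 - 'X^(k.+1)) * gauss n.+1 k.+1 = (1 - 'X^(n.+1)) * gauss n k.
Proof.
have [lt_nk|le_kn] := ltnP n k; first by rewrite !gauss_small ?mulr0.
have := gauss_qfact k.+1 (n - k); have := gauss_qfact k (n - k).
rewrite addSn subnKC // => E1 E2.
have nz : qfact k * qfact (n - k) != 0 by rewrite mulf_neq0 ?qfact_neq0.
apply: (mulIf nz); rewrite -[RHS]mulrA E1 [RHS]mulrC -qfactS -E2 qfactS.
ring.
Qed.

Lemma modn_pred (d j s : nat) : (0 < d)%N ->
  (j.+1 %% d = s.+1)%N -> (j %% d = s)%N.
Proof.
move=> d_gt0 Ej; have lt_sd : (s.+1 < d)%N by rewrite -Ej ltn_mod.
have /eqP : (j + 1 = s + 1 %[mod d])%N by rewrite !addn1 Ej modn_small.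
by rewrite eqn_modDr => /eqP ->; rewrite modn_small // ltnW.
Qed.

(* Each use of gauss_absorb lowers both residues by one, until n is divisible by d
   and its factor 1 - z^n vanishes. *)
Lemma gauss_root (F : fieldType) (z : F) (d n k : nat) :
    d.-primitive_root z -> (n %% d < k %% d)%N ->
  (map_poly intr (gauss n k)).[z] = 0.
Proof.
move=> zP; move Er: (n %% d)%N => r.
elim: r n k Er => [|r IHr] n k Er lt_rk.
all: have k_gt0 : (0 < k)%N by case: k lt_rk => //; rewrite mod0n.
all: case: k k_gt0 lt_rk => // k _ lt_rk.
all: case: n Er => [|n] Er; first by rewrite gauss_small // rmorph0 horner0.
all: have := congr1 (fun p => (map_poly intr p).[z]) (gauss_absorb n k).
all: rewrite ![map_poly _ (_ * _)]rmorphM /= ![map_poly _ (_ - _)]rmorphB /=.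
all: rewrite !rmorph1 /= !map_polyXn !hornerE /=.
all: have nz : 1 - z ^+ k.+1 != 0
  by rewrite subr_eq0 eq_sym -(prim_order_dvd zP) /dvdn; move: lt_rk; case: (_ %% _)%N.
- have /eqP -> : z ^+ n.+1 == 1 by rewrite -(prim_order_dvd zP) /dvdn Er.
  by rewrite subrr mul0r => /eqP; rewrite mulf_eq0 (negPf nz) => /eqP.
have d_gt0 := prim_order_gt0 zP.
have pred_mod j s := @modn_pred d j s d_gt0.
rewrite (IHr n k (pred_mod _ _ Er)).
  by rewrite mulr0 => /eqP; rewrite mulf_eq0 (negPf nz) => /eqP.
by case Ek: (k.+1 %% d)%N lt_rk => [|s] //; rewrite (pred_mod _ _ Ek).
Qed.

Lemma qbinomE n k : qbinom qvar n k = tofrac (gauss n k).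
Proof.
rewrite /qbinom; case: leqP => [le_kn|lt_nk]; last by rewrite gauss_small // rmorph0.
have qE i : 1 - qvar ^+ i = tofrac (1 - 'X^i) by rewrite rmorphB rmorph1 rmorphXn.
have falling j : (j <= n)%N ->
    \prod_(0 <= i < j) (1 - 'X^(n - i)) * qfact (n - j) = qfact n.
  elim: j => [|j IHj] lt_jn; first by rewrite big_geq // mul1r subn0.
  rewrite big_nat_recr //= -mulrA [X in _ * X]mulrC -(subnSK lt_jn) -qfactS.
  by rewrite subnSK // IHj // ltnW.
under eq_bigr do rewrite qE; under [in X in _ / X]eq_bigr do rewrite qE.
rewrite -!rmorph_prod -/(qfact k).
have nz : tofrac (qfact k) != 0 by rewrite tofrac_eq0 qfact_neq0.
apply: (mulIf nz); rewrite divfK // -rmorphM; congr (tofrac _).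
have nz' := qfact_neq0 (n - k); apply: (mulIf nz').
by rewrite falling // -mulrA -{1}(subnKC le_kn) -gauss_qfact subnKC.
Qed.

(** * Unimodality of the level sizes *)

Definition level (n k r : nat) : {set {set 'I_n}} :=
  [set S : {set 'I_n} | (#|S| == k) && (\sum_(i in S) i == r)%N].

Section Sl2.
Variable n : nat.
(** Occupation numbers range over all integers so that hops can be added and subtracted freely;
    subsets correspond to the 0/1-valued configurations. *)
Notation conf := {ffun 'I_n.+1 -> int}.
Implicit Types (e : conf) (f g : conf -> rat) (b c : 'I_n) (k r : int).

Definition lo b : 'I_n.+1 := widen_ord (leqnSn n) b.
Definition hi b : 'I_n.+1 := lift ord0 b.
Definition hop b : conf := [ffun i => (i == lo b)%:R - (i == hi b)%:R].
(* The matrix coefficients of the irreducible representation of dimension n + 1. *)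
Definition wt b : rat := (b.+1 * (n - b))%N%:R.

(* On 0/1-valued e both integer weights below are the indicator that the hop is
   allowed. This affine form makes operators of distinct bonds commute identically
   and confines the image of a function supported on 0/1-valued e to such e. *)
Definition raising f e : rat :=
  \sum_b wt b * ((e (lo b) + 1) * (2 - e (hi b)))%:~R * f (e + hop b).
Definition lowering f e : rat :=
  \sum_b ((2 - e (lo b)) * (e (hi b) + 1))%:~R * f (e - hop b).

Definition binary e := [forall i, (e i == 0) || (e i == 1)].
Definition particles e : int := \sum_i e i.
Definition energy e : int := \sum_(i < n.+1) i%:Z * e i.
Definition in_sector k r f :=
  forall e, f e != 0 -> [/\ binary e, particles e = k & energy e = r].

Lemma lo_inj : injective lo.
Proof. by move=> b c /(congr1 val) /= /val_inj. Qed.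

Lemma hi_inj : injective hi.
Proof. exact: lift_inj. Qed.

Lemma lo_neq_hi b : lo b != hi b.
Proof. by rewrite -val_eqE /= /bump /=; lia. Qed.

(** Terms of distinct bonds cancel: a shared site contributes the same two factors in either order.
    For a single bond and binary [e], the two products of weights are the indicators of ([e (lo b)],
    [e (hi b)]) = (0, 1) and (1, 0). *)
Lemma commutator_diag e f : binary e ->
  raising (lowering f) e - lowering (raising f) e =
  (\sum_b wt b * (e (hi b) - e (lo b))%:~R) * f e.
Proof.
move=> /forallP bin_e; rewrite /raising /lowering.
under eq_bigr do rewrite mulr_sumr.
under [X in _ - X]eq_bigr do rewrite mulr_sumr.
rewrite [X in _ - X]exchange_big -sumrB mulr_suml; apply: eq_bigr => b _.
rewrite -sumrB (bigD1 b) //= big1 => [|c neq_cb].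
  rewrite addr0 !ffunE !eqxx (negPf (lo_neq_hi b)) eq_sym (negPf (lo_neq_hi b)).
  rewrite [e + _ - _]addrK [e - _ + _]subrK !mulrb.
  by case/orP: (bin_e (lo b)) => /eqP->; case/orP: (bin_e (hi b)) => /eqP->;
     rewrite /=; ring.
rewrite !ffunE !(inj_eq lo_inj) !(inj_eq hi_inj) (negPf neq_cb).
rewrite eq_sym in neq_cb; rewrite (negPf neq_cb).
rewrite -[e + hop b - hop c]addrA [hop b - _]addrC addrA.
rewrite [hi c == lo b]eq_sym [lo c == hi b]eq_sym.
case: (eqVneq (lo b) (hi c)) => [E1|_]; case: (eqVneq (hi b) (lo c)) => [E2|_];
 rewrite ?E1 ?E2 /=; ring.
Qed.

(** Summation by parts: the coefficient of [e i] is i (n + 1 - i) - (i + 1) (n - i) = 2i - n. Hence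
    the commutator is a scalar on each sector. *)
Lemma binary_mass e : \sum_b wt b * (e (hi b) - e (lo b))%:~R
  = (energy e *+ 2 - n%:Z * particles e)%:~R.
Proof.
rewrite /energy /particles.
have -> : \sum_b wt b * (e (hi b) - e (lo b))%:~R =
  (\sum_(b < n) (b.+1 * (n - b))%N%:Z * (e (hi b) - e (lo b)))%:~R :> rat.
  by rewrite rmorph_sum; apply: eq_bigr => b _; rewrite rmorphM.
congr (_%:~R).
under eq_bigr do rewrite mulrBr.
rewrite sumrB.
have -> : \sum_(b < n) (b.+1 * (n - b))%N%:Z * e (hi b) =
    \sum_(i < n.+1) (i * (n.+1 - i))%N%:Z * e i.
  rewrite [RHS]big_ord_recl mul0n mul0r add0r; apply: eq_bigr => b _.
  by rewrite /hi /= /bump /= add1n subSS.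
have -> : \sum_(b < n) (b.+1 * (n - b))%N%:Z * e (lo b) =
    \sum_(i < n.+1) (i.+1 * (n - i))%N%:Z * e i.
  by rewrite [RHS]big_ord_recr /= subnn muln0 mul0r addr0.
rewrite -sumrB mulr_sumr -sumrMnl -sumrB; apply: eq_bigr => i _.
rewrite -mulrBl -mulrnAl -mulrBl; congr (_ * _).
have := ltn_ord i; nia.
Qed.

Lemma particlesD e e' : particles (e + e') = particles e + particles e'.
Proof. by rewrite -big_split; apply: eq_bigr => i _; rewrite ffunE. Qed.

Lemma energyD e e' : energy (e + e') = energy e + energy e'.
Proof. by rewrite -big_split; apply: eq_bigr => i _; rewrite ffunE mulrDr. Qed.

Lemma sum_pick (F : 'I_n.+1 -> int) i : \sum_j F j * (j == i)%:R = F i.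
Proof.
rewrite (bigD1 i) //= eqxx mulr1 big1 ?addr0 // => j /negPf->.
by rewrite mulr0.
Qed.

Lemma particles_hop b : particles (hop b) = 0.
Proof.
rewrite /particles; under eq_bigr do rewrite ffunE -[X in X - _]mul1r -[X in _ - X]mul1r.
by rewrite sumrB !sum_pick.
Qed.

Lemma energy_hop b : energy (hop b) = -1.
Proof.
rewrite /energy; under eq_bigr do rewrite ffunE mulrBr.
by rewrite sumrB !sum_pick /= /bump /=; lia.
Qed.

Lemma particlesN e : particles (- e) = - particles e.
Proof. by rewrite -sumrN; apply: eq_bigr => i _; rewrite ffunE. Qed.

Lemma energyN e : energy (- e) = - energy e.
Proof. by rewrite -sumrN; apply: eq_bigr => i _; rewrite ffunE mulrN. Qed.

Lemma sum_neq0 (F : 'I_n -> rat) : \sum_b F b != 0 -> exists b, F b != 0.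
Proof.
move=> nz; apply/existsP; apply: contra_neqT nz => /existsPn F0.
by rewrite big1 // => b _; apply/eqP; have := F0 b; rewrite negbK.
Qed.

(** In terms of the argument [e + hop b] of [f], a nonzero weight forces [lo b] occupied and [hi b]
    empty, so undoing the hop leaves [e] binary, with one more unit of energy. *)
Lemma raising_sector k r f : in_sector k r f -> in_sector k (r + 1) (raising f).
Proof.
move=> sf e /sum_neq0[b]; rewrite !mulf_eq0 !negb_or intr_eq0 mulf_eq0 negb_or.
case/andP=> /andP[_ /andP[lo_nz hi_nz]] /sf[/forallP bin pk er].
split.
- apply/forallP => i; have := bin i; rewrite !ffunE.
  case: (eqVneq i (lo b)) => [->|_].
    by rewrite (negPf (lo_neq_hi b)) !mulrb /=; move: lo_nz; lia.
  by rewrite !mulrb /=; case: (eqVneq i (hi b)) => [->|_]; move: hi_nz; lia.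
- by rewrite -pk particlesD particles_hop addr0.
- by rewrite -er energyD energy_hop; lia.
Qed.

Lemma lowering_sector k r f : in_sector k r f -> in_sector k (r - 1) (lowering f).
Proof.
move=> sf e /sum_neq0[b]; rewrite !mulf_eq0 !negb_or intr_eq0 mulf_eq0 negb_or.
case/andP=> /andP[lo_nz hi_nz] /sf[/forallP bin pk er].
split.
- apply/forallP => i; have := bin i; rewrite !ffunE.
  case: (eqVneq i (lo b)) => [->|_].
    by rewrite (negPf (lo_neq_hi b)) !mulrb /=; move: lo_nz; lia.
  by rewrite !mulrb /=; case: (eqVneq i (hi b)) => [->|_]; move: hi_nz; lia.
- by rewrite -pk particlesD particlesN particles_hop subr0.
- by rewrite -er energyD energyN energy_hop; lia.
Qed.

Lemma commutator k r f e : in_sector k r f ->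
  raising (lowering f) e = lowering (raising f) e + (r *+ 2 - n%:Z * k)%:~R * f e.
Proof.
move=> sf; case: (boolP (binary e)) => [bin_e|nbin_e].
  apply/eqP; rewrite -subr_eq0 opprD addrA commutator_diag // binary_mass.
  case: (eqVneq (f e) 0) => [->|/sf[_ -> ->]]; first by rewrite !mulr0 subr0.
  by rewrite subrr.
have off g r' : in_sector k r' g -> g e = 0.
  by move=> sg; apply/eqP; apply: contraNT nbin_e => /sg[].
rewrite (off _ _ sf) (off _ _ (raising_sector (lowering_sector sf))).
by rewrite (off _ _ (lowering_sector (raising_sector sf))) mulr0 addr0.
Qed.

Lemma loweringZ (a : rat) f e : lowering (fun e => a * f e) e = a * lowering f e.
Proof. by rewrite mulr_sumr; apply: eq_bigr => b _; rewrite mulrCA. Qed.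

Lemma eq_raising f g : f =1 g -> raising f =1 raising g.
Proof. by move=> fg e; apply: eq_bigr => b _; rewrite fg. Qed.

Lemma eq_lowering f g : f =1 g -> lowering f =1 lowering g.
Proof. by move=> fg e; apply: eq_bigr => b _; rewrite fg. Qed.

(* If f is killed by the raising operator, then raising the (i+1)-st lowering of f
   gives c_i times the i-th one with c_i < 0; since lowering eventually reaches
   negative energy, f = 0. *)
Lemma raising_inj k (r : nat) f :
    in_sector k r f -> (r : int) *+ 2 < n%:Z * k ->
  raising f =1 (fun=> 0) -> f =1 (fun=> 0).
Proof.
move=> sf lt_r Xf0; pose Y i := iter i lowering f.
have sY i : in_sector k (r%:Z - i%:Z) (Y i).
  elim: i => [|i IHi]; first by rewrite subr0.
  by have := lowering_sector IHi; congr in_sector; lia.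
have XY i : exists2 c : rat, c < 0 & forall e, raising (Y i.+1) e = c * Y i e.
  elim: i => [|i [c c_lt0 IHi]].
    exists (r%:Z *+ 2 - n%:Z * k)%:~R; first by rewrite ltrz0 subr_lt0.
    move=> e; rewrite /Y /= (commutator e sf) (eq_lowering Xf0) /lowering big1 ?add0r //.
    by move=> b _; rewrite mulr0.
  exists (c + ((r%:Z - i.+1%:Z) *+ 2 - n%:Z * k)%:~R).
    rewrite -[X in _ < X]addr0 ltrD // ltrz0; move: lt_r; lia.
  by move=> e; rewrite /= (commutator e (sY i.+1)) (eq_lowering IHi) loweringZ mulrDl.
have Ylast : Y r.+1 =1 (fun=> 0).
  move=> e; apply/eqP; apply/negPn/negP => /sY[/forallP bin _ er].
  suff : 0 <= energy e by rewrite er; lia.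
  by apply: sumr_ge0 => i _; case/orP: (bin i) => /eqP->; rewrite ?mulr0 ?mulr1.
have down i : Y i.+1 =1 (fun=> 0) -> Y i =1 (fun=> 0).
  move=> Y0 e; have [c c_lt0 /(_ e)] := XY i.
  rewrite (eq_raising Y0) /raising big1 => [/esym/eqP|b _]; last by rewrite mulr0.
  by rewrite mulf_eq0 (lt_eqF c_lt0) => /eqP.
have all0 i : Y (r.+1 - i)%N =1 (fun=> 0).
  elim: i => [|i IHi]; first by rewrite subn0.
  have [lt_ir|le_ri] := ltnP i r.+1; first by apply: down; rewrite subnSK.
  (* Both truncated differences are 0 here. *)
  by move: IHi; rewrite (eqP le_ri) (eqP (leqW le_ri)).
by have := all0 r.+1; rewrite subnn.
Qed.

(** * Subsets as binary configurations, and growth of the levels *)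

Definition indic (S : {set 'I_n.+1}) : conf := [ffun i => (i \in S)%:R].

Lemma indic_inj : injective indic.
Proof.
move=> S S' /ffunP E; apply/setP => i; have := E i; rewrite !ffunE.
by case: (i \in S); case: (i \in S').
Qed.

Lemma binary_indic S : binary (indic S).
Proof. by apply/forallP => i; rewrite ffunE; case: (i \in S). Qed.

Lemma indic_of_binary e : binary e -> e = indic [set i | e i == 1].
Proof.
move=> /forallP bin; apply/ffunP => i; rewrite !ffunE inE.
by case/orP: (bin i) => /eqP->.
Qed.

Lemma particles_indic S : particles (indic S) = #|S|%:Z.
Proof.
rewrite /particles -sum1_card [in RHS]big_mkcond /= (big_morph Posz PoszD (erefl _)).
by apply: eq_bigr => i _; rewrite ffunE; case: (i \in S).
Qed.

Lemma energy_indic S : energy (indic S) = (\sum_(i in S) i)%N%:Z.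
Proof.
rewrite /energy [in RHS]big_mkcond /=.
rewrite (big_morph Posz PoszD (erefl _)).
by apply: eq_bigr => i _; rewrite ffunE; case: (i \in S); rewrite ?mulr1 ?mulr0.
Qed.

Lemma mem_level (k r : nat) S : (S \in level n.+1 k r) =
  (particles (indic S) == k%:Z) && (energy (indic S) == r%:Z).
Proof. by rewrite inE particles_indic energy_indic !eqz_nat. Qed.

(** If the level shrank, the matrix [M] of the raising operator would have more rows than columns; a
    nonzero kernel vector then gives a nonzero [f] killed by raising, against [raising_inj]. *)
Lemma level_mono (k r : nat) : (r.*2 < n * k)%N -> (#|level n.+1 k r| <= #|level n.+1 k r.+1|)%N.
Proof.
move=> lt_r; rewrite leqNgt; apply/negP => lt_card.
pose dlt (i : 'I_#|level n.+1 k r|) e : rat := (e == indic (enum_val i))%:R.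
pose M := \matrix_(i < #|level n.+1 k r|, j < #|level n.+1 k r.+1|)
  raising (dlt i) (indic (enum_val j)).
have kerM : kermx M != 0.
  rewrite kermx_eq0 /row_free neq_ltn (leq_ltn_trans (rank_leq_col M)) //.
have /rowV0Pn[v v_ker v_nz] := kerM.
pose f e := \sum_i v 0 i * dlt i e.
have sf : in_sector k r f.
  move=> e fe_nz; have /existsP[i] : [exists i : 'I_#|level n.+1 k r|, e == indic (enum_val i)].
    apply: contra_neqT fe_nz => /existsPn e_out.
    by rewrite /f big1 // => i _; rewrite /dlt (negPf (e_out i)) mulr0.
  move=> /eqP->; have := enum_valP i; rewrite mem_level => /andP[/eqP pk /eqP er].
  by split; rewrite ?binary_indic.
have Xf e : raising f e = \sum_i v 0 i * raising (dlt i) e.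
  rewrite /raising; under [RHS]eq_bigr do rewrite mulr_sumr.
  rewrite exchange_big; apply: eq_bigr => b _; rewrite mulr_sumr.
  by apply: eq_bigr => i _; rewrite mulrCA.
(* Off the level [r.+1] the value vanishes by [raising_sector]; on it, the value is an entry of
   [v *m M]. *)
have Xf0 : raising f =1 (fun=> 0).
  move=> e; apply/eqP; apply/negPn/negP => Xfe_nz.
  have [bin pk er] := raising_sector sf Xfe_nz.
  move: pk er Xfe_nz; rewrite (indic_of_binary bin); set S := [set i | _] => pk er.
  have SL : S \in level n.+1 k r.+1 by rewrite mem_level pk er eqxx /=; lia.
  move/negP; apply; rewrite Xf.
  have /sub_kermxP /rowP /(_ (enum_rank_in SL S)) := v_ker.
  rewrite !mxE => E; rewrite -[X in _ == X]E; apply/eqP; apply: eq_bigr => i _.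
  by rewrite mxE enum_rankK_in.
have f0 := raising_inj sf _ Xf0.
case/eqP: v_nz; apply/rowP => i; rewrite mxE.
have := f0 _ (indic (enum_val i)); rewrite /f (bigD1 i) //= /dlt eqxx mulr1 big1.
  by rewrite addr0; apply; lia.
move=> j neq_ji; rewrite (inj_eq indic_inj) (inj_eq enum_val_inj) eq_sym.
by rewrite (negPf neq_ji) mulr0.
Qed.
End Sl2.

(** * Symmetric unimodal polynomials *)

Definition row_gf n : {poly {poly int}} := \prod_(i < n) (('X^i)%:P * 'X + 1).

(** The q-binomial theorem. The exponents in the inductive step agree since C(k+1, 2) + (n - k) =
    C(k, 2) + n. *)
Lemma coef_row_gf n k : (row_gf n)`_k = 'X^'C(k, 2) * gauss n k.
Proof.
elim: n k => [|n IHn] k.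
  by rewrite /row_gf big_ord0 coef1; case: k => [|k] /=; rewrite ?mulr1 ?mulr0.
rewrite /row_gf big_ord_recr -/(row_gf n) /= mulrDr mulr1 coefD mulrA coefMX.
rewrite coefMC !IHn.
case: k => [|k] /=; first by rewrite !gauss0 add0r.
rewrite -/(gauss n.+1 k.+1) gaussS mulrDr addrC; congr (_ + _).
have [lt_nk|le_kn] := ltnP n k; first by rewrite gauss_small // !mulr0 mul0r.
rewrite [RHS]mulrA -exprD mulrAC -exprD; congr ('X^ _ * _).
by rewrite binS bin1; lia.
Qed.

Lemma row_gfE n :
  row_gf n = \sum_(S : {set 'I_n}) ('X^(\sum_(i in S) i)%N)%:P * 'X^#|S|.
Proof.
rewrite /row_gf bigA_distr; apply: eq_bigr => S _.
rewrite -big_mkcond big_split /= prodr_const; congr (_ * _).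
by rewrite -rmorph_prod -expr_sum.
Qed.

(** The offset C(k, 2) = 0 + 1 + ... + (k - 1) is the least sum of k distinct sites. *)
Lemma card_level n k j : #|level n k ('C(k, 2) + j)|%:Z = (gauss n k)`_j.
Proof.
have -> : (gauss n k)`_j = ('X^'C(k, 2) * gauss n k)`_('C(k, 2) + j).
  by rewrite coefXnM ltnNge leq_addr addKn.
rewrite -coef_row_gf row_gfE !coef_sum -sum1_card big_mkcond /=.
rewrite (big_morph Posz PoszD (erefl _)); apply: eq_bigr => S _.
rewrite coefMXn coefC inE.
case: (ltngtP #|S| k) => [lt|_|->]; last 1 first.
- by rewrite subnn /= coefXn eq_sym; case: eqP.
- by rewrite subn_eq0 leqNgt lt /= coef0.
- by rewrite coef0.
Qed.

Lemma level_rev n k r : (r <= k * n.-1)%N -> #|level n k (k * n.-1 - r)| = #|level n k r|.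
Proof.
move=> le_r.
pose rv (S : {set 'I_n}) := [set rev_ord i | i in S].
have rvK : involutive rv.
  move=> S; apply/setP => i; apply/imsetP/idP => [[j /imsetP[l lS ->] ->]|iS].
    by rewrite rev_ordK.
  by exists (rev_ord i); rewrite ?rev_ordK // imset_f.
have card_rv S : #|rv S| = #|S| by rewrite card_imset //; apply: rev_ord_inj.
have sum_rv S : (\sum_(i in rv S) i + \sum_(i in S) i = #|S| * n.-1)%N.
  rewrite big_imset /=; last by move=> ? ? _ _; apply: rev_ord_inj.
  rewrite -big_split -sum_nat_const; apply: eq_bigr => i _ /=.
  by have := ltn_ord i; lia.
rewrite -(card_imset _ (inv_inj rvK)); apply: eq_card => S.
apply/imsetP/idP => [[S' + ->]|SL]; last first.
  exists (rv S); rewrite ?rvK //; move: SL; rewrite !inE card_rv.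
  case/andP=> /eqP Ek /eqP Er; have := sum_rv S; rewrite Ek Er eqxx /= => <-.
  by rewrite addnK.
rewrite !inE card_rv => /andP[/eqP Ek /eqP Er].
have := sum_rv S'; rewrite Ek Er eqxx /= => E.
by rewrite -(eqn_add2r (k * n.-1 - r)) E subnKC.
Qed.

(** * Sums of segments with a common centre *)

Definition qseg m : {poly int} := \sum_(i < m) 'X^i.

(* A block with i + i + m = D + 1 occupies the degrees i, ..., D - i. *)
Inductive sym_unimodal (D : nat) : {poly int} -> Prop :=
| SymUnimodal0 : sym_unimodal D 0
| SymUnimodalAdd i m p : (i.*2 + m = D.+1)%N -> sym_unimodal D p ->
    sym_unimodal D ('X^i * qseg m + p).

Lemma qsegE m : qseg m = \poly_(i < m) 1.
Proof. by rewrite poly_def; apply: eq_bigr => i _; rewrite scale1r. Qed.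

Lemma sym_unimodal_block D i m : (i.*2 + m = D.+1)%N -> sym_unimodal D ('X^i * qseg m).
Proof. by move=> ?; rewrite -[_ * _]addr0; apply: SymUnimodalAdd => //; apply: SymUnimodal0. Qed.

Lemma sym_unimodalD D p q : sym_unimodal D p -> sym_unimodal D q -> sym_unimodal D (p + q).
Proof.
by move=> up uq; elim: up => [|i m p' E _ IH]; rewrite ?add0r // -addrA; apply: SymUnimodalAdd.
Qed.

Lemma sym_unimodalZ D (c : int) p : 0 <= c -> sym_unimodal D p -> sym_unimodal D (c *: p).
Proof.
case: c => // c _ up; rewrite -[Posz c]natz scaler_nat.
elim: c => [|c IHc]; first exact: SymUnimodal0.
by rewrite mulrS; apply: sym_unimodalD.
Qed.

Lemma sym_unimodal_shift D i p : sym_unimodal D p -> sym_unimodal (i.*2 + D) ('X^i * p).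
Proof.
elim=> [|j m p' E _ IH]; first by rewrite mulr0; apply: SymUnimodal0.
by rewrite mulrDr mulrA -exprD; apply: SymUnimodalAdd => //; lia.
Qed.

Lemma qseg_sub1 m : (1 - 'X) * qseg m = 1 - 'X^m.
Proof.
elim: m => [|m IHm]; first by rewrite /qseg big_ord0 mulr0 subrr.
by rewrite /qseg big_ord_recr -/(qseg m) /= mulrDr IHm exprS; ring.
Qed.

(** Peels the longest segment off the product, leaving a shifted product of shorter segments with
    the same centre. *)
Lemma qseg_mul m l :
  qseg m.+1 * qseg l.+1 = qseg (m + l).+1 + 'X * (qseg m * qseg l).
Proof.
have nz : (1 - 'X) * (1 - 'X) != 0 :> {poly int}.
  by have := @qint_neq0 1 isT; rewrite expr1 => nz; rewrite mulf_neq0.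
apply: (mulfI nz).
have -> : (1 - 'X) * (1 - 'X) * (qseg m.+1 * qseg l.+1)
   = ((1 - 'X) * qseg m.+1) * ((1 - 'X) * qseg l.+1) by ring.
have -> : (1 - 'X) * (1 - 'X) * (qseg (m + l).+1 + 'X * (qseg m * qseg l))
   = (1 - 'X) * ((1 - 'X) * qseg (m + l).+1)
     + 'X * (((1 - 'X) * qseg m) * ((1 - 'X) * qseg l)) by ring.
by rewrite !qseg_sub1 !exprS exprD; ring.
Qed.

Lemma sym_unimodal_qseg_mul D m l : (m + l = D.+2)%N -> sym_unimodal D (qseg m * qseg l).
Proof.
elim: m D l => [|m IHm] D l E; first by rewrite /qseg big_ord0 mul0r; apply: SymUnimodal0.
case: l E => [|l] E; first by rewrite /qseg big_ord0 mulr0; apply: SymUnimodal0.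
rewrite qseg_mul; apply: sym_unimodalD.
  by rewrite -[qseg _]mul1r -(expr0 'X); apply: sym_unimodal_block; lia.
case: m E IHm => [|m] E IHm.
  by rewrite {1}/qseg big_ord0 mul0r mulr0; apply: SymUnimodal0.
case: l E => [|l] E.
  by rewrite {2}/qseg big_ord0 !mulr0; apply: SymUnimodal0.
have -> : D = (1.*2 + D.-2)%N by lia.
by rewrite -['X]expr1; apply: sym_unimodal_shift; apply: IHm; lia.
Qed.

Lemma sym_unimodalM D E p q :
  sym_unimodal D p -> sym_unimodal E q -> sym_unimodal (D + E) (p * q).
Proof.
move=> up uq; elim: up => [|i m p' Ei _ IHp]; first by rewrite mul0r; apply: SymUnimodal0.
rewrite mulrDl; apply: sym_unimodalD => //; elim: uq => [|j l q' Ej _ IHq].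
  by rewrite mulr0; apply: SymUnimodal0.
rewrite mulrDr; apply: sym_unimodalD => //; rewrite mulrACA -exprD.
case: m Ei {IHq} => [|m] Ei; first by rewrite {1}/qseg big_ord0 mul0r mulr0; apply: SymUnimodal0.
case: l Ej => [|l] Ej; first by rewrite {2}/qseg big_ord0 !mulr0; apply: SymUnimodal0.
have -> : (D + E = (i + j).*2 + (m + l))%N by lia.
by apply: sym_unimodal_shift; apply: sym_unimodal_qseg_mul; lia.
Qed.

(** Subtracting [u 0] copies of the full segment clears both end coefficients, by symmetry; the rest
    is ['X] times a polynomial of the same kind for [D - 2]. *)
Lemma sym_unimodal_poly D (u : nat -> int) :
    0 <= u 0%N -> (forall i, (i.+1.*2 <= D)%N -> u i <= u i.+1) ->
    (forall i, (i <= D)%N -> u (D - i)%N = u i) ->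
  sym_unimodal D (\poly_(i < D.+1) u i).
Proof.
elim/ltn_ind: D u => D IHD u u0 u_mono u_sym.
have qD m : (m = D.+1)%N -> sym_unimodal D (u 0%N *: qseg m).
  move=> ->; apply: sym_unimodalZ => //.
  by rewrite -[qseg _]mul1r -(expr0 'X); apply: sym_unimodal_block.
case: D => [|[|D]] in IHD u_mono u_sym qD *.
- have -> : \poly_(i < 1) u i = u 0%N *: qseg 1; last exact: qD.
  by apply/polyP => -[|i]; rewrite qsegE coefZ !coef_poly /= ?mulr1 ?mulr0.
- have -> : \poly_(i < 2) u i = u 0%N *: qseg 2; last exact: qD.
  apply/polyP => -[|[|i]]; rewrite qsegE coefZ !coef_poly /= ?mulr1 ?mulr0 //.
  by rewrite (u_sym 0%N).
have -> : \poly_(i < D.+3) u i =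
    u 0%N *: qseg D.+3 + 'X^1 * \poly_(i < D.+1) (u i.+1 - u 0%N).
  apply/polyP => -[|i]; rewrite qsegE coefD coefZ coefXnM !coef_poly /= ?mulr1 ?addr0 //.
  rewrite subn1 /= !ltnS; case: (ltngtP i D.+1) => [lt|gt|->].
  - by rewrite -ltnS lt mulr1 addrC subrK.
  - by rewrite leqNgt (ltnW gt) /= mulr0 addr0.
  - by rewrite ltnn mulr1 addr0 -(u_sym 0%N).
apply: sym_unimodalD; first exact: qD.
have -> : D.+2 = (1.*2 + D)%N by [].
apply: sym_unimodal_shift; apply: IHD; first lia.
- by rewrite subr_ge0; apply: u_mono.
- by move=> i lt_i; rewrite lerD2r; apply: u_mono; lia.
- by move=> i le_i; rewrite -(u_sym i.+1) ?subSS ?subSn //; lia.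
Qed.

Lemma size_gauss n k : (size (gauss n k) <= (k * (n - k)).+1)%N.
Proof.
elim: n k => [|n IHn] [|k] /=; rewrite ?size_poly1 ?size_poly0 //.
rewrite (leq_trans (size_polyD _ _)) // geq_max; apply/andP; split.
  by apply: leq_trans (IHn _) _; rewrite ltnS leq_mul2l; lia.
have [lt_nk|le_kn] := ltnP n k; first by rewrite (gauss_small lt_nk) mulr0 size_poly0.
apply: leq_trans (size_polyMleq _ _) _; rewrite size_polyXn /=.
have := IHn k; set s := size _; nia.
Qed.

(** Coefficient i is the size of the level of energy C(k, 2) + i. Since 2 C(k, 2) + k (n - k) = k (n
    - 1), the middle degree corresponds to the middle energy. *)
Lemma sym_unimodal_gauss n k : (k <= n)%N -> sym_unimodal (k * (n - k)) (gauss n k).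
Proof.
move=> le_kn.
have bin2k : ('C(k, 2).*2 = k * k.-1)%N.
  by rewrite bin2 -[RHS]odd_double_half; case: k {le_kn} => // k; rewrite oddM /= andNb.
have -> : gauss n k = \poly_(i < (k * (n - k)).+1) (gauss n k)`_i.
  apply/polyP => i; rewrite coef_poly; case: ltnP => // le_i.
  by rewrite nth_default // (leq_trans (size_gauss _ _)).
apply: sym_unimodal_poly => [|i lt_i|i le_i].
- by rewrite -card_level.
- rewrite -!card_level lez_nat addnS.
  case: n le_kn lt_i => [|n] le_kn lt_i; first by move: lt_i; nia.
  apply: level_mono; nia.
- rewrite -!card_level; congr Posz.
  rewrite -[RHS]level_rev; last nia.
  by congr #|level _ _ _|; nia.
Qed.

(** For one block, a degree k in its shift by g but not in the block satisfies k > D - i and k >= i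
    + g, so 2k > D + g; in the opposite case 2k < D + g. *)
Lemma sym_unimodal_sub D p g k : sym_unimodal D p ->
  ((k.*2 <= D + g)%N -> 0 <= ((1 - 'X^g) * p)`_k) /\
  ((D + g <= k.*2)%N -> ((1 - 'X^g) * p)`_k <= 0).
Proof.
elim=> [|i m q E _ [IH1 IH2]]; first by rewrite mulr0 coef0.
rewrite mulrDr coefD.
suff [H1 H2] : ((k.*2 <= D + g)%N -> 0 <= ((1 - 'X^g) * ('X^i * qseg m))`_k) /\
  ((D + g <= k.*2)%N -> ((1 - 'X^g) * ('X^i * qseg m))`_k <= 0).
  by split=> le_k; [rewrite addr_ge0 ?H1 ?IH1 | rewrite -[0]addr0 lerD ?H2 ?IH2].
rewrite mulrBl mul1r coefB coefXnM !coefXnM qsegE !coef_poly.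
by split=> le_k; repeat case: ifP => ?; lia.
Qed.

Lemma quotient_coef_ge0 D (A B : {poly int}) (g N : nat) :
    (0 < N)%N -> sym_unimodal D A -> B * (1 - 'X^N) = (1 - 'X^g) * A ->
  forall k, 0 <= B`_k.
Proof.
move=> N_gt0 uA eqAB.
have coefB_ k : B`_k - (if (k < N)%N then 0 else B`_(k - N)) = ((1 - 'X^g) * A)`_k.
  by rewrite -eqAB mulrBr mulr1 coefB coefMXn.
have low k : (k.*2 <= D + g)%N -> 0 <= B`_k.
  elim/ltn_ind: k => k IHk le_k; have [/(_ le_k) + _] := sym_unimodal_sub g k uA.
  rewrite -coefB_; case: ltnP => [_|le_Nk]; first by rewrite subr0.
  by have := IHk (k - N)%N; lia.
(* Downward induction from [size B], where coefficients vanish: the coefficient at k is at least the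
   one at k + N. *)
have high j k : (size B <= k + j)%N -> (D + g <= k.*2)%N -> 0 <= B`_k.
  elim: j k => [|j IHj] k le_j le_k; first by rewrite nth_default // -[k]addn0.
  have le_j' : (size B <= k + N + j)%N by apply: leq_trans le_j _; lia.
  have [_ H] := sym_unimodal_sub g (k + N) uA.
  have := H ltac:(lia); rewrite -coefB_ addnK ltnNge leq_addl /=.
  by rewrite subr_le0; apply: le_trans; apply: IHj => //; lia.
by move=> k; case: (leqP k.*2 (D + g)) => [/low//|/ltnW]; apply: (high (size B)); apply: leq_addl.
Qed.

(** * Divisibility *)

(** The divisor is monic, so division stays over the integers; the remainder has degree below N and
    N distinct complex roots. *)
Lemma dvd_Xn_sub1 (N : nat) (P : {poly int}) : (0 < N)%N ->
    (forall z : algC, z ^+ N = 1 -> (map_poly intr P).[z] = 0) ->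
  exists B, B * ('X^N - 1) = P.
Proof.
move=> N_gt0 P0.
have monX : 'X^N - 1 \is @monic int by rewrite monic_Xn_sub_1.
exists (P %/ ('X^N - 1)).
have E := Pdiv.IdomainMonic.divp_eq monX P.
set R := P %% _ in E; suff R0 : R = 0 by rewrite [RHS]E R0 addr0.
have inj_int : injective (intr : int -> algC) by exact: intr_inj.
have ltR : (size (map_poly intr R : {poly algC}) < N.+1)%N.
  rewrite size_map_inj_poly // -(size_Xn_sub_1 int N_gt0).
  by rewrite ltn_modp monic_neq0.
apply: (map_inj_poly inj_int) => //; rewrite rmorph0.
have [z zP] := C_prim_root_exists N_gt0.
pose rs := [seq z ^+ i | i <- index_iota 0 N].
apply: (@roots_geq_poly_eq0 _ _ rs).
- apply/allP => _ /mapP[i _ ->]; rewrite /root.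
  have zi1 : (z ^+ i) ^+ N = 1 by rewrite exprAC (prim_expr_order zP) expr1n.
  have := P0 _ zi1; rewrite E rmorphD rmorphM rmorphB /= map_polyXn rmorph1.
  by rewrite !hornerE zi1 subrr mulr0 add0r => ->.
- rewrite map_inj_in_uniq ?iota_uniq // => i j; rewrite !mem_index_iota => /= lti ltj.
  by move/eqP; rewrite (eq_prim_root_expr zP) !modn_small // => /eqP.
- by rewrite size_map size_iota subn0.
Qed.

(** Let x, y be the residues of am, bm modulo d, with x nonzero. If y = 0 or x + y > d, the first
    Gaussian vanishes: its upper residue is x - 1 or x + y - d - 1. Otherwise an, bn have residues d
    - x, d - y, and d - x - y < d - x makes the second vanish. *)
Lemma gauss_prod_root (a b m n : nat) (z : algC) :
    (0 < b)%N -> (0 < m)%N ->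
    z ^+ (m + n) = 1 ->
  (map_poly intr ((1 - 'X^(a * m)) *
     (gauss (a * m + b * m - 1) (a * m) * gauss (a * n + b * n) (a * n)))).[z] = 0.
Proof.
move=> b_gt0 m_gt0 z1; rewrite !rmorphM /= rmorphB /= map_polyXn rmorph1 !hornerE /=.
have [->|za_neq1] := eqVneq (z ^+ (a * m)) 1; first by rewrite subrr !mul0r.
have mn_gt0 : (0 < m + n)%N by rewrite addn_gt0 m_gt0.
have [d zP _] := prim_order_exists mn_gt0 z1.
have d_gt0 := prim_order_gt0 zP.
have dvd_d : (d %| m + n)%N by rewrite (prim_order_dvd zP) z1.
have ndvd : ~~ (d %| a * m)%N by rewrite (prim_order_dvd zP).
suff : (((a * m + b * m - 1) %% d < (a * m) %% d) || ((a * n + b * n) %% d < (a * n) %% d))%N.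
  by case/orP=> /(gauss_root zP) ->; rewrite ?mulr0 ?mul0r.
have opp c : (c * m %% d != 0)%N -> (c * n %% d = d - c * m %% d)%N.
  move=> nz; rewrite -[RHS](@modn_small _ d); last by lia.
  apply/eqP; rewrite -(eqn_modDl (c * m)%N) -mulnDr.
  have /eqP -> : (d %| c * (m + n))%N by rewrite dvdn_mull.
  rewrite {1}(divn_eq (c * m) d) -addnA subnKC; last by rewrite ltnW ?ltn_mod.
  by rewrite modnMDl modnn.
move: ndvd; rewrite /dvdn => x_nz; have := opp a x_nz.
rewrite [((a * n + _) %% _)%N]modnD //.
have lt_x := ltn_pmod (a * m) d_gt0; have lt_y := ltn_pmod (b * m) d_gt0.
have E1 := modnD (a * m) (b * m) d_gt0.
have Epred : (0 < (a * m + b * m) %% d)%N ->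
    ((a * m + b * m - 1) %% d = ((a * m + b * m) %% d).-1)%N.
  move=> s_gt0; apply: (modn_pred d_gt0); rewrite subn1 !prednK // lt0n.
  by apply: contraTneq s_gt0 => ->; rewrite mod0n.
have [y0|y_nz] := eqVneq (b * m %% d)%N 0%N.
  have Es : ((a * m + b * m) %% d = a * m %% d)%N.
    by rewrite E1 y0 addn0 leqNgt lt_x subn0.
  by move=> _; rewrite Epred Es ?ltn_predL lt0n x_nz.
rewrite (opp b y_nz) => ->; move: Epred; rewrite E1 => {E1 opp dvd_d za_neq1 zP z1}.
move: (a * m %% d)%N (b * m %% d)%N x_nz y_nz lt_x lt_y => x y x_nz y_nz lt_x lt_y Epred.
have [le_xy|lt_xy] := leqP (x + y) d.
  by apply/orP; right; case: leqP => ?; lia.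
apply/orP; left; rewrite (ltnW lt_xy) mul1n in Epred.
by rewrite Epred; lia.
Qed.

Theorem corollary6p2 (a b m n : nat)
  (ha : (1 <= a)%N) (hb : (1 <= b)%N) (hm : (1 <= m)%N) (hn : (1 <= n)%N) :
  exists p : {poly int},
    (forall i : nat, 0 <= p`_i) /\
    (1 - qvar ^+ (a * m)) / (1 - qvar ^+ (m + n))
      * qbinom qvar (a * m + b * m - 1) (a * m)
      * qbinom qvar (a * n + b * n) (a * n) = tofrac p.
Proof.
have mn_gt0 : (0 < m + n)%N by rewrite addn_gt0 hm.
have bm_gt0 : (0 < b * m)%N by rewrite muln_gt0 hb.
set A := gauss (a * m + b * m - 1) (a * m) * gauss (a * n + b * n) (a * n).
have [B EB] := dvd_Xn_sub1 mn_gt0 (fun z => @gauss_prod_root a b m n z hb hm).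
have EA : (- B) * (1 - 'X^(m + n)) = (1 - 'X^(a * m)) * A.
  by rewrite -EB mulNr -mulrN opprB.
exists (- B); split.
  apply: (quotient_coef_ge0 mn_gt0 _ EA).
  (* [bm_gt0] ensures am <= am + bm - 1. *)
  by apply: sym_unimodalM; apply: sym_unimodal_gauss; lia.
have qE i : 1 - qvar ^+ i = tofrac (1 - 'X^i) by rewrite rmorphB rmorph1 rmorphXn.
rewrite !qbinomE !qE -mulrA -rmorphM mulrAC -rmorphM -EA rmorphM mulfK //.
by rewrite tofrac_eq0 qint_neq0.
Qed.
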